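(* The Virasoro-like algebra $V$ over $\mathbb{C}$ does not have nonzero $(-1)$-derivations; that is, if $D:V\to V$ is a linear map satisfying $D([x,y])=-[D(x),y]-[x,D(y)]$ for all $x,y\in V$, then $D=0$.
   Context: For $\mathbf{m}=(m_1,m_2),\mathbf{n}=(n_1,n_2)\in\mathbb{Z}^2$ write $\det\binom{\mathbf{n}}{\mathbf{m}}=n_1m_2-n_2m_1$. The Virasoro-like algebra $V$ is the complex Lie algebra with basis $\{L_{\mathbf{m}}\mid \mathbf{m}\in\mathbb{Z}^2\setminus\{\mathbf{0}\}\}$ and bracket $[L_{\mathbf{m}},L_{\mathbf{n}}]=\det\binom{\mathbf{n}}{\mathbf{m}}L_{\mathbf{m}+\mathbf{n}}$, with the convention $L_{\mathbf{0}}=0$. For $\delta\in\mathbb{C}$, a $\delta$-derivation of a Lie algebra $L$ is a linear map $D:L\to L$ with $D([x,y])=\delta([D(x),y]+[x,D(y)])$ for all $x,y\in L$. *)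

(* Defs.v *)
From HB Require Import structures.
From mathcomp Require Import all_boot all_order all_algebra.
From mathcomp Require Import finmap monalg.
From mathcomp Require Import complex reals.
From mathcomp Require Import ring.

Set Implicit Arguments.
Unset Strict Implicit.
Unset Printing Implicit Defensive.

Import GRing.Theory.
Local Open Scope ring_scope.

Reserved Notation "[[ x , y ]]" (at level 0, x, y at level 99,
  format "[[ x ,  y ]]").

HB.mixin Record Lmodule_isLieAlgebra (K : comNzRingType) V
    of GRing.Lmodule K V := {
  lie_bracket : V -> V -> V;
  lie_linearl : forall y, linear (lie_bracket^~ y);
  lie_linearr : forall x, linear (lie_bracket x);
  liexx : forall x, lie_bracket x x = 0;
  lie_jacobi : forall x y z,
    lie_bracket x (lie_bracket y z) + lie_bracket y (lie_bracket z x)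
      + lie_bracket z (lie_bracket x y) = 0
}.

#[short(type="lieAlgType")]
HB.structure Definition LieAlgebra (K : comNzRingType) :=
  {V of Lmodule_isLieAlgebra K V & GRing.Lmodule K V}.

Notation "[[ x , y ]]" := (lie_bracket x y) : ring_scope.

Definition delta_derivation (K : comNzRingType) (A : lieAlgType K) (delta : K)
    (D : {linear A -> A}) : Prop :=
  forall x y : A, D [[x, y]] = delta *: ([[D x, y]] + [[x, D y]]).

Definition virIndex : choiceType := {m : int * int | m != 0}.

(* det2 n m is the determinant of the matrix with rows n and m. *)
Definition det2 (n m : int * int) : int := n.1 * m.2 - n.2 * m.1.

(* The free K-module on virIndex: finitely supported families of scalars. *)
Definition virasoroLike (K : comNzRingType) : Type := {malg K[virIndex]}.
HB.instance Definition _ (K : comNzRingType) :=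
  GRing.Lmodule.on (virasoroLike K).

Section VirasoroLike.
Variable K : comNzRingType.
Local Notation V := (virasoroLike K).
Implicit Types (x y z : V) (m n p : int * int).

(* The basis vector L_m when m != 0, with the convention L_0 = 0. *)
Definition virL m : V :=
  if insub m is Some k then (<< (k : virIndex) >> : {malg K[virIndex]}) else 0.

(* The bilinear extension of [L_m, L_n] = det2 n m *: L_(m + n). *)
Definition vir_bracket x y : V :=
  \sum_(m <- msupp x) \sum_(n <- msupp y)
     (x@_m * y@_n * (det2 (val n) (val m))%:~R) *: virL (val m + val n).

Lemma virL0 : virL 0 = 0.
Proof. by rewrite /virL insubF ?eqxx. Qed.

Lemma virL_val (k : virIndex) :
  virL (val k) = (<< k >> : {malg K[virIndex]}).
Proof. by rewrite /virL valK. Qed.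

Lemma vir_expand x : x = \sum_(k <- msupp x) x@_k *: virL (val k).
Proof.
rewrite {1}[x]monalgE; apply: eq_bigr => k _; rewrite virL_val.
by apply/malgP => k'; rewrite mcoeffZ !mcoeffU mulr_natr.
Qed.

Let lin0 (f : V -> V) : linear f -> f 0 = 0.
Proof.
by move=> lf; have := lf (-1) 0 0; rewrite !scaleN1r oppr0 addr0 addNr.
Qed.

Let extE (f : virIndex -> V) x (d : {fset virIndex}) :
  (msupp x `<=` d)%fset ->
  \sum_(k <- msupp x) x@_k *: f k = \sum_(k <- d) x@_k *: f k.
Proof.
move=> sub; apply: big_fset_incl => // k _ kx.
by rewrite mcoeff_outdom // scale0r.
Qed.

Let ext_linear (f : virIndex -> V) :
  linear (fun x => \sum_(k <- msupp x) x@_k *: f k).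
Proof.
move=> a x y /=.
pose d := (msupp x `|` msupp y `|` msupp (a *: x + y))%fset.
rewrite (@extE f x d) ?(@extE f y d) ?(@extE f _ d) //.
- rewrite scaler_sumr -big_split; apply: eq_bigr => k _ /=.
  by rewrite mcoeffD mcoeffZ scalerDl scalerA.
- exact: fsubsetUr.
- by rewrite /d -fsetUA fsetUCA fsubsetUl.
- by rewrite /d -fsetUA fsubsetUl.
Qed.

Let bracketEl x y : vir_bracket x y =
  \sum_(m <- msupp x) x@_m *: \sum_(n <- msupp y)
     y@_n *: ((det2 (val n) (val m))%:~R *: virL (val m + val n)).
Proof.
apply: eq_bigr => m _; rewrite scaler_sumr; apply: eq_bigr => n _.
by rewrite !scalerA.
Qed.

Let bracketEr x y : vir_bracket x y =
  \sum_(n <- msupp y) y@_n *: \sum_(m <- msupp x)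
     x@_m *: ((det2 (val n) (val m))%:~R *: virL (val m + val n)).
Proof.
rewrite /vir_bracket exchange_big; apply: eq_bigr => n _.
rewrite scaler_sumr; apply: eq_bigr => m _.
by rewrite !scalerA [y@_n * _]mulrC.
Qed.

Fact vir_linearl y : linear (vir_bracket^~ y).
Proof. by move=> a x x' /=; rewrite !bracketEl ext_linear. Qed.

Fact vir_linearr x : linear (vir_bracket x).
Proof. by move=> a y y' /=; rewrite !bracketEr ext_linear. Qed.

Lemma vir_bracketL m n :
  vir_bracket (virL m) (virL n) = (det2 n m)%:~R *: virL (m + n).
Proof.
have [->|m0] := eqVneq m 0.
  by rewrite virL0 (lin0 (vir_linearl _)) /det2 !mulr0 subrr scale0r.
have [->|n0] := eqVneq n 0.
  by rewrite virL0 (lin0 (vir_linearr _)) /det2 !mul0r subrr scale0r.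
rewrite -[m]/(val (Sub m m0 : virIndex)) -[n]/(val (Sub n n0 : virIndex)).
rewrite /vir_bracket !virL_val !msuppU oner_eq0 !big_seq_fset1 !mcoeffUU.
by rewrite !mul1r.
Qed.

Let vir_ind (f : V -> V) : linear f -> (forall m, f (virL m) = 0) ->
  forall x, f x = 0.
Proof.
move=> lf f0 x; rewrite [x]vir_expand.
elim: (X in \sum_(k <- X) _) => [|k s IH]; first by rewrite big_nil lin0.
by rewrite big_cons lf f0 scaler0 add0r IH.
Qed.

Let lin_add (f g : V -> V) : linear f -> linear g ->
  linear (fun x => f x + g x).
Proof. by move=> lf lg a x y; rewrite lf lg scalerDr addrACA. Qed.

Let lin_comp (f g : V -> V) : linear f -> linear g -> linear (fun x => f (g x)).
Proof. by move=> lf lg a x y; rewrite lg lf. Qed.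

Let vir_anti x y : vir_bracket x y + vir_bracket y x = 0.
Proof.
move: x; apply: vir_ind => [|m].
  exact: lin_add (vir_linearl y) (vir_linearr y).
move: y; apply: vir_ind => [|n].
  exact: lin_add (vir_linearr _) (vir_linearl _).
rewrite !vir_bracketL [n + m]addrC -scalerDl -intrD.
by rewrite (_ : _ + _ = 0) ?scale0r // /det2; ring.
Qed.

Fact vir_bracketxx x : vir_bracket x x = 0.
Proof.
rewrite [x]vir_expand; elim: (msupp x : seq _) => [|k s].
  by rewrite big_nil (lin0 (vir_linearl _)).
rewrite big_cons; set u := \sum_(j <- s) _ => IH.
rewrite vir_linearl !vir_linearr IH addr0 vir_bracketL.
rewrite (_ : det2 _ _ = 0) ?scale0r; last by rewrite /det2; ring.
by rewrite scaler0 add0r -scalerDr vir_anti scaler0.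
Qed.

Fact vir_jacobi x y z :
  vir_bracket x (vir_bracket y z) + vir_bracket y (vir_bracket z x)
    + vir_bracket z (vir_bracket x y) = 0.
Proof.
have ll := vir_linearl; have lr := vir_linearr.
move: x; apply: vir_ind => [|m].
  apply: lin_add; [apply: lin_add|].
  - exact: ll.
  - exact: lin_comp (lr _) (lr _).
  - exact: lin_comp (lr _) (ll _).
move: y; apply: vir_ind => [|n].
  apply: lin_add; [apply: lin_add|].
  - exact: lin_comp (lr _) (ll _).
  - exact: ll.
  - exact: lin_comp (lr _) (lr _).
move: z; apply: vir_ind => [|p].
  apply: lin_add; [apply: lin_add|].
  - exact: lin_comp (lr _) (lr _).
  - exact: lin_comp (lr _) (ll _).
  - exact: ll.
have brZ a u v : vir_bracket u (a *: v) = a *: vir_bracket u v.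
  by rewrite -[a *: v]addr0 (lr u) (lin0 (lr u)) addr0.
rewrite !vir_bracketL !brZ !vir_bracketL !scalerA.
rewrite [n + (p + m)]addrC -[p + m + n]addrA [m + (n + p)]addrC.
rewrite [p + (m + n)]addrA -[n + p + m]addrA [n + (p + m)]addrC.
rewrite -!scalerDl -!intrM -!intrD.
by rewrite (_ : _ + _ = 0) ?scale0r // /det2 /=; ring.
Qed.

HB.instance Definition _ := Lmodule_isLieAlgebra.Build K V
  vir_linearl vir_linearr vir_bracketxx vir_jacobi.

Lemma lie_virL m n : [[virL m, virL n]] = (det2 n m)%:~R *: virL (m + n).
Proof. exact: vir_bracketL. Qed.

End VirasoroLike.

(* Main.v *)
(** A linear map [D] splits into homogeneous components
    [L_m |-> d_s m *: L_(m + s)], and comparing coefficients shows that each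
    component is again a (-1)-derivation; with [w m n := det2 n m] this reads
      [w m n * d (m + n) + w (m + s) n * d m + w m (n + s) * d n = 0].
    For [s = 0] this is [d (m + n) = - d m - d n] for non-collinear [m, n];
    computing [d (2 m + n)] in two ways kills [d].
    For [s != 0], taking [n := - s] gives [d (m - s) = - d m] off the line
    through [s]; then the three identities for the pairs [(2 n + j s, n)],
    [j = 0, 1, 2], form a regular linear system in [d n], [d (2 n)], [d (3 n)].
    Finally each nonzero [p] on the line through [s] is a sum of two
    non-collinear vectors off that line. *)
Require Import Defs.
From mathcomp Require Import all_boot all_order all_algebra.
From mathcomp Require Import finmap monalg.
From mathcomp Require Import complex reals.
From mathcomp Require Import ring.

Set Implicit Arguments.
Unset Strict Implicit.
Unset Printing Implicit Defensive.

Import GRing.Theory.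
Local Open Scope ring_scope.

(** * Coordinates in the basis and brackets with basis vectors *)

Section Coefficients.
Variable K : comNzRingType.
Local Notation V := (virasoroLike K).

(* The coefficient of [L_p] in [x], with value [0] at [p = 0]. *)
Definition vir_coef (p : int * int) (x : V) : K :=
  if insub p is Some k then (x : {malg K[virIndex]})@_(k : virIndex) else 0.

Lemma vir_coef_linear p (a : K) (x y : V) :
  vir_coef p (a *: x + y) = a * vir_coef p x + vir_coef p y.
Proof.
rewrite /vir_coef; case: insubP => [k _ _|_]; last by rewrite mulr0 addr0.
by rewrite mcoeffD mcoeffZ.
Qed.

Lemma vir_coefZ p (a : K) (x : V) : vir_coef p (a *: x) = a * vir_coef p x.
Proof.
have z : vir_coef p 0 = 0.
  by rewrite /vir_coef; case: insubP => // *; rewrite mcoeff0.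
by rewrite -[a *: x]addr0 vir_coef_linear z addr0.
Qed.

Lemma vir_coefD p (x y : V) :
  vir_coef p (x + y) = vir_coef p x + vir_coef p y.
Proof. by rewrite -[x in x + y]scale1r vir_coef_linear mul1r. Qed.

Lemma vir_coef_eq0 (x : V) : (forall p, vir_coef p x = 0) -> x = 0.
Proof.
move=> x0; apply/malgP => k.
by have := x0 (val k); rewrite /vir_coef valK mcoeff0.
Qed.

Lemma vir_coefL p m : vir_coef p (virL K m) = ((m == p) && (p != 0))%:R.
Proof.
rewrite /vir_coef /virL; case: (insubP _ p) => [k pn0 <-|]; last first.
  by rewrite negbK => /eqP ->; rewrite eqxx andbF.
rewrite (valP k) andbT; case: insubP => [l _ <-|].
  by rewrite mcoeffU val_eqE.
rewrite negbK => /eqP ->; rewrite mcoeff0 eq_sym.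
by have /negPf -> := valP k.
Qed.

Lemma vir_linear_eq0 (U : lmodType K) (f : V -> U) :
  linear f -> (forall m, f (virL K m) = 0) -> forall x, f x = 0.
Proof.
move=> lf f0 x.
have f00 : f 0 = 0 by have := lf (-1) 0 0; rewrite !scaleN1r oppr0 addr0 addNr.
rewrite [x]vir_expand; elim: (X in \sum_(k <- X) _) => [|k s IH].
  by rewrite big_nil.
by rewrite big_cons lf f0 scaler0 add0r IH.
Qed.

Lemma vir_coef_bracketr p n (x : V) :
  vir_coef p [[x, virL K n]] = (det2 n (p - n))%:~R * vir_coef (p - n) x.
Proof.
(* Both sides are linear in [x], so basis vectors suffice; [K^o] makes the scalars a module over
   themselves. *)
pose f (x : V) : K^o :=
  vir_coef p [[x, virL K n]] - (det2 n (p - n))%:~R * vir_coef (p - n) x.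
suff: f x = 0 by move/eqP; rewrite subr_eq0 => /eqP.
move: x; apply: vir_linear_eq0 => [a x y|m]; rewrite /f.
  rewrite lie_linearl !vir_coef_linear.
  by rewrite /GRing.scale /=; ring.
apply/eqP; rewrite subr_eq0; apply/eqP.
rewrite lie_virL vir_coefZ !vir_coefL.
rewrite (can2_eq (addrK n) (subrK n)).
have [->|] := eqVneq m (p - n); last by rewrite !mulr0.
 (* If [p] or [p - n] is zero, a coefficient is zero by convention, and the determinant vanishes as
    well. *)
 have [p0|pn0] := eqVneq p 0; have [pn|pn] := eqVneq (p - n) 0;
  rewrite ?mulr0 ?mulr1 //=.
  by rewrite p0 /det2 /= (_ : _ - _ = 0) //; case: (n) => ? ? /=; ring.
by rewrite pn /det2 !mulr0 subrr.
Qed.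

Lemma vir_coef_bracketl p m (x : V) :
  vir_coef p [[virL K m, x]] = (det2 (p - m) m)%:~R * vir_coef (p - m) x.
Proof.
have anti : [[virL K m, x]] = (-1) *: [[x, virL K m]].
  apply/eqP; rewrite scaleN1r -addr_eq0; apply/eqP.
  have := liexx (virL K m + x).
  have D1 y (u v : V) : [[u + v, y]] = [[u, y]] + [[v, y]].
    by have := lie_linearl y 1 u v; rewrite !scale1r.
  have D2 y (u v : V) : [[y, u + v]] = [[y, u]] + [[y, v]].
    by have := lie_linearr y 1 u v; rewrite !scale1r.
  by rewrite D1 !D2 !liexx add0r addr0.
rewrite anti vir_coefZ vir_coef_bracketr mulrA -[-1]/((-1)%:~R) -intrM.
by congr (_%:~R * _); rewrite /det2; ring.
Qed.

End Coefficients.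

Lemma det2_neq0_ex (p : int * int) : p != 0 -> exists m, det2 p m != 0.
Proof.
case: p => a b; have [-> b0|a0 _] := eqVneq a 0.
  exists (1, 0); rewrite /det2 /= mul0r mulr1 sub0r oppr_eq0.
  by apply: contraNneq b0 => ->.
by exists (0, 1); rewrite /det2 /= mulr0 mulr1 subr0.
Qed.

(** * Vanishing of one homogeneous component *)

Section HomogeneousComponent.
Variables (K : numDomainType) (s : int * int) (d : int * int -> K).
Local Notation w m n := ((det2 n m)%:~R : K).
Hypothesis d_eq : forall m n,
  w m n * d (m + n) + w (m + s) n * d m + w m (n + s) * d n = 0.

Let w_eq0 m n : (w m n == 0) = (det2 n m == 0).
Proof. exact: intr_eq0. Qed.

Lemma degree0_component_eq0 (m : int * int) : s = 0 -> m != 0 -> d m = 0.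
Proof.
move=> s0; have dD p q : det2 q p != 0 -> d (p + q) = - d p - d q.
  move=> h; have := d_eq p q; rewrite s0 !addr0 -!mulrDr => /eqP.
  rewrite mulf_eq0 w_eq0 (negPf h) /= -addrA addr_eq0 => /eqP ->.
  by rewrite opprD.
have d2 p q : det2 q p != 0 -> d (p + p) = - (d q *+ 2).
  move=> h; have e1 : d (p + (p + q)) = - d p - d (p + q).
    by apply: dD; rewrite (_ : det2 _ _ = det2 q p) // /det2 /=; ring.
  have e2 : d (p + p + q) = - d (p + p) - d q.
    apply: dD; rewrite (_ : det2 _ _ = det2 q p *+ 2); last first.
      by rewrite /det2 /=; ring.
    by rewrite Num.Theory.mulrn_eq0.
  move: e1; rewrite addrA e2 (dD _ _ h) => e.
  transitivity (- (- d (p + p) - d q) - d q); first by ring.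
  by rewrite e; ring.
(* By [d2], both [q] and [p + q] compute [d (p + p)], so [d (p + q) = d q]. *)
have dhalf p q : det2 q p != 0 -> d p = - (d q *+ 2).
  move=> h; have h' : det2 (p + q) p != 0.
    by rewrite (_ : det2 _ _ = det2 q p) // /det2 /=; ring.
  have := d2 _ _ h'; rewrite (dD _ _ h) (d2 _ _ h) => /oppr_inj.
  move=> /(Num.Theory.pmulrnI (isT : (0 < 2)%N)) e.
  by rewrite mulr2n {1}e; ring.
move=> /det2_neq0_ex [n h].
have e1 : d n = - (d m *+ 2) by apply: dhalf.
have e2 : d m = - (d n *+ 2).
  by apply: dhalf; rewrite (_ : det2 _ _ = - det2 m n) ?oppr_eq0 // /det2; ring.
rewrite e1 in e2.
(* Substitution gave [d m = 4 d m], that is [3 d m = 0]. *)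
apply/eqP; rewrite -[_ == 0]/(false || _) -(@Num.Theory.mulrn_eq0 _ _ 3).
apply/eqP; transitivity (- (- (d m *+ 2) *+ 2) - d m); first by ring.
by rewrite -e2 subrr.
Qed.

(** In [d_eq m (- s)] the unknown [d (- s)] has coefficient [w m 0 = 0], and the other two
    coefficients agree. *)
Lemma component_shift m : det2 s m != 0 -> d (m - s) = - d m.
Proof.
move=> h; have := d_eq m (- s); rewrite addNr.
rewrite (_ : det2 0 m = 0); last by rewrite /det2 /=; ring.
rewrite (_ : det2 (- s) (m + s) = - det2 s m); last by rewrite /det2 /=; ring.
rewrite (_ : det2 (- s) m = - det2 s m); last by rewrite /det2 /=; ring.
rewrite mul0r addr0 -mulrDr => /eqP; rewrite mulf_eq0 intr_eq0.
by rewrite oppr_eq0 (negPf h) addr_eq0 => /eqP.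
Qed.

Lemma component_off_line_eq0 n : det2 s n != 0 -> d n = 0.
Proof.
move=> h; have det2n k : det2 s (n *+ k) = det2 s n *+ k.
  by elim: k => [|k IH]; rewrite ?mulr0n ?mulrS -?IH /det2 /=; ring.
have dS k : (0 < k)%N -> d (n *+ k + s) = - d (n *+ k).
  move=> k0; have /component_shift : det2 s (n *+ k + s) != 0.
    rewrite (_ : det2 _ _ = det2 s (n *+ k)); last by rewrite /det2 /=; ring.
    by rewrite det2n Num.Theory.mulrn_eq0 negb_or -lt0n k0.
  by rewrite addrK => ->; rewrite opprK.
have dSS k : (0 < k)%N -> d (n *+ k + s + s) = d (n *+ k).
  move=> k0; have /component_shift : det2 s (n *+ k + s + s) != 0.
    rewrite (_ : det2 _ _ = det2 s (n *+ k)); last by rewrite /det2 /=; ring.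
    by rewrite det2n Num.Theory.mulrn_eq0 negb_or -lt0n k0.
  by rewrite addrK dS // => /oppr_inj.
(* Each shift by [s] flips the sign, so only [d n], [d (2 n)], [d (3 n)] occur below. Collinearity
   of [2 n] with [n] removes [d (3 n)] from [e0], and that of [2 n + 2 s] with [n + s] removes [d n]
   from [e2]. *)
pose b := w s n.
have e0 : b * d (n *+ 2) - 2 * b * d n = 0.
  rewrite -[RHS](d_eq (n *+ 2) n) /b /det2 /=; ring.
have e1 : - b * d (n *+ 3) - 2 * b * d (n *+ 2) - b * d n = 0.
  have := d_eq (n *+ 2 + s) n.
  rewrite [n *+ 2 + s + n]addrAC -mulrSr !dS // => <-.
  rewrite /b /det2 /=; ring.
have e2 : 2 * b * d (n *+ 3) + 3 * b * d (n *+ 2) = 0.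
  have := d_eq (n *+ 2 + s + s) n.
  rewrite (addrAC _ s n) (addrAC _ s n) -mulrSr !dSS // => <-.
  rewrite /b /det2 /=; ring.
have : (4 * b) * d n = 0.
  (* The combination [- e0 - 2 e1 - e2] of the three identities. *)
  rewrite -[RHS]oppr0 -[X in - X](addr0 0) -{1}e2 -[X in _ + X](mulr0 2) -e1.
  rewrite -[RHS]subr0 -e0; ring.
move/eqP; rewrite !mulf_eq0 Num.Theory.pnatr_eq0 /= w_eq0.
rewrite (_ : det2 n s = - det2 s n); last by rewrite /det2; ring.
by rewrite oppr_eq0 (negPf h) /= => /eqP.
Qed.

Lemma component_eq0 (m : int * int) : m != 0 -> d m = 0.
Proof.
move=> m0; have [s0|s0] := eqVneq s 0; first exact: degree0_component_eq0.
have [hm|] := eqVneq (det2 s m) 0; last exact: component_off_line_eq0.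
have [p hp] := det2_neq0_ex m0.
have hps : det2 s p != 0.
  (* Cramer's rule: [det2 m p * s = det2 s p * m - det2 s m * p], read in each coordinate. *)
  apply: contra_neq s0 => hps; suff: (det2 m p * s.1 = 0) /\ (det2 m p * s.2 = 0).
    move=> [/eqP + /eqP]; rewrite !mulf_eq0 (negPf hp) /=.
    by case: (s) => a b /= /eqP -> /eqP ->.
  split; [rewrite (_ : _ * _ = det2 s p * m.1 - det2 s m * p.1)
         |rewrite (_ : _ * _ = det2 s p * m.2 - det2 s m * p.2)];
    by [rewrite hps hm !mul0r subrr | rewrite /det2; ring].
have hq : det2 s (m - p) != 0.
  rewrite (_ : det2 _ _ = det2 s m - det2 s p); last by rewrite /det2 /=; ring.
  by rewrite hm sub0r oppr_eq0.
have := d_eq p (m - p); rewrite subrKC.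
rewrite (component_off_line_eq0 hps) (component_off_line_eq0 hq) !mulr0 !addr0.
rewrite (_ : det2 (m - p) p = det2 m p); last by rewrite /det2 /=; ring.
by move/eqP; rewrite mulf_eq0 w_eq0 (negPf hp) /= => /eqP.
Qed.

End HomogeneousComponent.

Lemma vir_delta_derivationN1_eq0 (K : numDomainType)
    (D : {linear virasoroLike K -> virasoroLike K}) :
  delta_derivation (-1) D -> forall x, D x = 0.
Proof.
move=> hD; apply: vir_linear_eq0 => [a x y|m]; first exact: linearP.
have [->|m0] := eqVneq m 0; first by rewrite virL0 linear0.
apply: vir_coef_eq0 => p.
(* This is the component of [D] of degree [p - m]; its value at [m] is the coefficient of [L_p] in
   [D L_m]. *)
pose d n := vir_coef (n + (p - m)) (D (virL K n)).
rewrite -[p](subrKC m) -[LHS]/(d m); apply: (@component_eq0 _ (p - m)) m0.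
move=> n q; rewrite /d; move: (p - m) => s.
(* Bracketing with a basis vector only shifts degrees, so this coefficient involves no other
   component of [D]. *)
have /(congr1 (vir_coef (n + q + s))) := hD (virL K n) (virL K q).
rewrite lie_virL linearZ /= !vir_coefZ vir_coefD.
rewrite vir_coef_bracketl vir_coef_bracketr.
rewrite (_ : n + q + s - q = n + s); last by rewrite addrAC addrK.
rewrite (_ : n + q + s - n = q + s); last first.
  by rewrite -[n + q + s]addrA [n + (q + s)]addrC addrK.
by move=> ->; ring.
Qed.

Theorem theorem3p1 (R : realType)
    (D : {linear virasoroLike R[i] -> virasoroLike R[i]})
    (hD : delta_derivation (-1) D) :
  forall x : virasoroLike R[i], D x = 0.
Proof. exact: vir_delta_derivationN1_eq0. Qed.
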